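(* Let $G$ be a connected graph whose endomorphism motion $m_e(G)$ is uncountable. If $|\operatorname{End}(G)| \leq m_e(G)$, then $D_e(G) = 2$.
   Context: Graphs are simple. An endomorphism of $G=(V,E)$ is a map $\phi: V\to V$ such that $\phi(u)\phi(v)\in E$ whenever $uv\in E$; $\operatorname{End}(G)$ is the set of all endomorphisms. The motion of $\phi$ is the cardinal $m(\phi) = |\{v : \phi(v)\neq v\}|$ and the endomorphism motion is $m_e(G) = \min_{\phi\in\operatorname{End}(G)\setminus\{\mathrm{id}\}} m(\phi)$ (a cardinal). A labeling $c$ is preserved by $\phi$ if $c(\phi(v)) = c(v)$ for all $v$. The endomorphism distinguishing number $D_e(G)$ is the least cardinal $d$ such that $G$ has a labeling with $d$ labels preserved only by the identity endomorphism. *)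

(* Defs.v *)
From mathcomp Require Import all_boot all_classical.

Set Implicit Arguments.
Unset Strict Implicit.
Unset Printing Implicit Defensive.

Local Open Scope classical_set_scope.
Local Open Scope card_scope.

Record sgraph (V : Type) := SGraph {
  adj : rel V;
  adj_sym : symmetric adj;
  adj_irr : irreflexive adj }.

Definition connected_graph (V : Type) (G : sgraph V) : Prop :=
  forall u v : V, exists p : seq V, path (adj G) u p /\ last u p = v.

Definition End (V : Type) (G : sgraph V) : set (V -> V) :=
  [set phi | forall u v, adj G u v -> adj G (phi u) (phi v)].

Definition moved (V : Type) (phi : V -> V) : set V := [set v | phi v <> v].

(* A cardinal is represented by an arbitrary type having that cardinality, so
   "m_e(G) = kappa" reads [is_endo_motion G M] for any M with |M| = kappa.
   The minimum is over non-identity endomorphisms: if there are none, no M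
   qualifies; if there is one, such an M exists (ex_endo_motion). *)
Definition is_endo_motion (V : Type) (G : sgraph V) (M : Type) : Prop :=
  (exists phi, [/\ End G phi, phi <> id & [set: M] #= moved phi]) /\
  (forall phi, End G phi -> phi <> id -> [set: M] #<= moved phi).

Definition preserves (V L : Type) (c : V -> L) (phi : V -> V) : Prop :=
  forall v, c (phi v) = c v.

(* L is the set of available labels; a labeling need not use all of them. *)
Definition endo_distinguishing (V : Type) (G : sgraph V) (L : Type)
    (c : V -> L) : Prop :=
  forall phi, End G phi -> preserves c phi -> phi = id.

(* "D_e(G) = |L|", with cardinals represented by types as above. *)
Definition is_endo_dist_number (V : Type) (G : sgraph V) (L : Type) : Prop :=
  (exists c : V -> L, endo_distinguishing G c) /\
  (forall (L' : Type) (c : V -> L'), endo_distinguishing G c ->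
     [set: L] #<= [set: L']).

Lemma least_cardinal (V : Type) (F : set (set V)) : F !=set0 ->
  exists2 A, F A & forall B, F B -> A #<= B.
Proof.
move=> [A0 FA0]; pose I := {A : set V | F A}.
pose P : set (set (I -> V)) := [set S |
  (forall s i, S s -> sval i (s i)) /\
  (forall s t i, S s -> S t -> s i = t i -> s = t)].
have [C CP Ctot|S [[Sin Sinj] Smax]] := @Zorn_bigcup _ P.
  split=> [s i [X CX Xs]|s t i [X CX Xs] [Y CY Yt]].
    by have [+ _] := CP _ CX; apply.
  have [XY|YX] := Ctot X Y CX CY.
    by have [_] := CP _ CY; apply=> //; exact: XY.
  by have [_] := CP _ CX; apply=> //; exact: YX.
have [i ihit] : exists i : I, forall x, sval i x -> exists2 s, S s & s i = x.
  apply: contrapT => /forallNP nohit.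
  have /choice[s0 s0P] : forall i : I, exists x,
      sval i x /\ forall s, S s -> s i <> x.
    move=> i; have /existsNP[x /not_implyP[ix nx]] := nohit i.
    by exists x; split=> // s Ss six; apply: nx; exists s.
  apply: (Smax (S `|` [set s0])).
    split=> [|sub]; first by move=> s Ss; left.
    have Ss0 : S s0 by apply: sub; right.
    by have [_ /(_ s0 Ss0)] := s0P (exist _ A0 FA0).
  split=> [s j [Ss|->]|s t j [Ss|->] [St|->] //].
  - exact: Sin.
  - by have [] := s0P j.
  - exact: Sinj.
  - by have [_ /(_ s Ss)] := s0P j.
  - by move=> /esym; have [_ /(_ t St)] := s0P j.
exists (sval i); first exact: svalP.
move=> B FB; pose j : I := exist _ B FB.
have /choice[f fP] : forall x, exists s, sval i x -> S s /\ s i = x.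
  move=> x; have [ix|nix] := pselect (sval i x).
    by have [s Ss six] := ihit x ix; exists s.
  by exists (fun=> x).
pose g x := f x j.
have gB : g @` sval i `<=` B.
  by move=> _ [x ix <-]; have [Sf _] := fP x ix; exact: (Sin _ j Sf).
have ginj : {in sval i &, injective g}.
  move=> x y /set_mem ix /set_mem iy gxy.
  have [Sfx fx] := fP x ix; have [Sfy fy] := fP y iy.
  by rewrite -fx -fy (Sinj _ _ j Sfx Sfy gxy).
apply: card_le_trans (subset_card_le gB).
by have /card_eqPle[_ ] := inj_card_eq ginj.
Qed.

Lemma ex_endo_motion (V : Type) (G : sgraph V) :
  (exists2 phi, End G phi & phi <> id) -> exists M : Type, is_endo_motion G M.
Proof.
move=> [phi0 E0 n0].
have [|_ [phi [Ephi nphi] <-] least] :=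
    @least_cardinal V (@moved V @` (End G `&` [set phi | phi <> id])).
  by exists (moved phi0); exists phi0.
exists {v | moved phi v}.
have eqM : [set: {v | moved phi v}] #= moved phi.
  have inj : {in setT &, injective (@sval V (moved phi))}.
    by move=> [x mx] [y my] _ _ /= exy; exact: eq_exist.
  have img : sval @` [set: {v | moved phi v}] = moved phi.
    apply/seteqP; split=> [_ [x _ <-]|x mx]; first exact: svalP.
    by exists (exist _ x mx).
  by have := inj_card_eq inj; rewrite img card_eq_sym.
split; first by exists phi.
by move=> psi Epsi npsi; rewrite (card_le_eql eqM); apply: least; exists psi.
Qed.

(* Main.v *)
(** Well-order the non-identity endomorphisms so that every proper initial
    segment has cardinality less than the motion.  For each [phi] in turn, pick
    a vertex [v phi] moved by [phi] which is neither an earlier [v psi] nor an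
    earlier [psi (v psi)]: the earlier endomorphisms forbid fewer vertices than
    [phi] moves.  If the image [phi (v phi)] is itself a picked vertex [v psi],
    then [psi] comes before [phi]; hence the requirement that [v phi] and
    [phi (v phi)] get different colors can be met by recursion along the
    well-order. *)
From Stdlib Require Import Inverse_Image.
Require Import Defs.
From mathcomp Require Import all_boot all_classical wochoice.

Set Implicit Arguments.
Unset Strict Implicit.

Local Open Scope classical_set_scope.
Local Open Scope card_scope.

(** A point of [B] serves as junk value outside [A], so that the injection becomes a total
    function. *)
Lemma card_le_fun (T U : Type) (A : set T) (B : set U) : A #<= B -> B !=set0 ->
  exists f : T -> U, (forall x, A x -> B (f x)) /\ {in A &, injective f}.
Proof.
move=> /card_leP[f] [b Bb].
exists (fun x => if pselect (A x) is left Ax then val (f (SigSub (mem_set Ax)))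
                 else b); split=> [x Ax|x y /set_mem Ax /set_mem Ay].
  by case: pselect => // Ax'; exact: set_valP.
case: pselect => // Ax'; case: pselect => // Ay' /val_inj.
by move=> /(@inj _ _ _ f _ _ (mem_set I) (mem_set I)) [].
Qed.

Lemma inj_fun_card_le (T U : Type) (A : set T) (B : set U) (f : T -> U) :
  (forall x, A x -> B (f x)) -> {in A &, injective f} -> A #<= B.
Proof.
move=> AB finj; have /card_eqPle[_ Af] := inj_card_eq finj.
by apply: card_le_trans Af (subset_card_le _) => _ [x Ax <-]; exact: AB.
Qed.

(* [X] is a maximal family of disjoint injective sequences in [A]; it misses
   only finitely many points, so [A] embeds into [X * nat]. *)
Lemma card_le_setX_bool (T : Type) (A : set T) : infinite_set A ->
  A `*` [set: bool] #<= A.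
Proof.
move=> Ainf; pose P : set (set (nat -> T)) := [set X |
  (forall s i, X s -> A (s i)) /\
  (forall s t i j, X s -> X t -> s i = t j -> s = t /\ i = j)].
have [C CP Ctot|X [[XA Xinj] Xmax]] := @Zorn_bigcup _ P.
  split=> [s i [Y CY Ys]|s t i j [Y CY Ys] [Z CZ Zt]].
    by have [+ _] := CP _ CY; apply.
  have [YZ|ZY] := Ctot Y Z CY CZ.
    by have [_] := CP _ CZ; apply=> //; exact: YZ.
  by have [_] := CP _ CY; apply=> //; exact: ZY.
pose S : set T := [set x | exists s i, X s /\ s i = x].
(* An infinite remainder would contain an injective sequence [e], which could be added to [X]. *)
have RfinN : ~ infinite_set (A `\` S).
  move=> /[dup] /infinite_setN0 R0 /infiniteP /card_le_fun /(_ R0) [e [eR einj]].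
  have {}einj i j : e i = e j -> i = j by apply: einj; rewrite inE.
  have [_ []] := eR 0 I; apply: contrapT => nSe0.
  apply: (Xmax (X `|` [set e])).
    split=> [|sub]; first by move=> s Xs; left.
    by apply: nSe0; exists e, 0; split=> //; apply: sub; right.
  split=> [s i [Xs|->]|s t i j [Xs|->] [Xt|->]].
  - exact: XA.
  - by have [] := eR i I.
  - exact: Xinj.
  - by move=> sij; have [_ []] := eR j I; exists s, i.
  - by move=> sij; have [_ []] := eR i I; exists t, j.
  - by move=> /einj.
have [s0 Xs0] : X !=set0.
  apply: contrapT => X0; apply: RfinN; suff -> : A `\` S = A by [].
  apply/seteqP; split=> [x []//|x Ax]; split=> // -[s [i [Xs _]]].
  by apply: X0; exists s.
have /card_le_fun[] : A `\` S #<= [set: nat].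
  by apply: finite_set_countable; apply: contrapT RfinN.
  by exists 0.
move=> r [_ rinj].
(* Points of [S] get even codes and the leftover points odd codes over the single sequence [s0], so
   parity separates the two kinds. *)
have /choice[p pP] : forall x, exists q : (nat -> T) * nat, A x ->
    X q.1 /\ ((S x /\ exists2 i, q.2 = i.*2 & q.1 i = x) \/
              (~ S x /\ q = (s0, (r x).*2.+1))).
  move=> x; have [Sx|nSx] := pselect (S x).
    have [s [i [Xs six]]] := Sx; exists (s, i.*2) => _; split=> //.
    by left; split=> //; exists i.
  by exists (s0, (r x).*2.+1) => _; split=> //; right.
have pinj x y : A x -> A y -> p x = p y -> x = y.
  move=> Ax Ay; have [_ px] := pP x Ax; have [_ py] := pP y Ay; move=> pxy.
  rewrite -{}pxy in py.
  case: px => [[_ [i xi six]]|[nSx px]]; case: py => [[_ [j yj sjy]]|[nSy py]].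
  - by rewrite -six -sjy; congr ((p x).1 _); apply: double_inj; rewrite -xi.
  - by move: xi; rewrite py => /(congr1 odd); rewrite /= !odd_double.
  - by move: yj; rewrite px => /(congr1 odd); rewrite /= !odd_double.
  - by move: py; rewrite px => -[] /double_inj rxy; apply: rinj; rewrite ?inE.
(* With [p x = (s, n)], the pair [(x, b)] goes to entry [2n + b] of [s]; the parity of the index
   recovers [b]. *)
apply: (@inj_fun_card_le _ _ _ _
  (fun z : T * bool => (p z.1).1 ((p z.1).2.*2 + z.2))).
  by move=> [x b] [/= Ax _]; apply: XA; have [] := pP x Ax.
move=> [x b] [y d] /set_mem[/= Ax _] /set_mem[/= Ay _].
have [Xx _] := pP x Ax; have [Xy _] := pP y Ay.
move=> /(Xinj _ _ _ _ Xx Xy) [s_eq i_eq].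
have bd : b = d.
  by have := congr1 odd i_eq; rewrite !oddD !odd_double !oddb.
congr pair => //; apply: pinj => //.
move: i_eq; rewrite bd => /addIn /double_inj i_eq.
by rewrite (surjective_pairing (p x)) s_eq i_eq -surjective_pairing.
Qed.

(** For a well-order [R], take [lt y x := ~ R x y]: an [R]-least non-accessible point would have
    only accessible predecessors. *)
Lemma well_founded_total (T : Type) : exists lt : T -> T -> Prop,
  well_founded lt /\ (forall x y, x <> y -> lt x y \/ lt y x).
Proof.
have [R Rwo] := well_ordering_principle {classic T}.
exists (fun y x => ~ R x y); split=> [x|x y xy].
  apply: contrapT => nAcc.
  pose B : {pred {classic T}} :=
    fun x => `[< ~ Acc (fun y x => ~ R x y) x >].
  have [|z [[/asboolP Bz zmin] _]] := Rwo B; first by exists x; apply/asboolP.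
  apply: Bz; constructor=> y Rzy; apply: contrapT => nAccy.
  by apply: Rzy; apply: zmin; apply/asboolP.
apply: contrapT => /not_orP[/contrapT Ryx /contrapT Rxy]; apply: xy.
have Rwo' : wo_chain R predT by move=> B _; exact: Rwo.
by apply: (wo_chain_antisymmetric Rwo') => //; rewrite Rxy Ryx.
Qed.

(* If some initial segment of a well-order is as large as [B], transport to [A]
   the order of the shortest such segment. *)
Lemma initial_well_order (T U : Type) (A : set T) (B : set U) : A #<= B ->
  exists lt : T -> T -> Prop, [/\ well_founded lt,
    forall x y, A x -> A y -> x <> y -> lt x y \/ lt y x &
    forall x, A x -> ~ (B #<= [set y | A y /\ lt y x])].
Proof.
move=> AB; have [lt [ltwf lt_total]] := well_founded_total T.
pose big x := A x /\ B #<= [set y | A y /\ lt y x].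
have [[x0 bigx0]|nobig] := pselect (exists x, big x); last first.
  exists lt; split=> // [x y _ _|x Ax Bx]; first exact: lt_total.
  by apply: nobig; exists x.
have [x [[Ax Bx] xmin]] : exists x, big x /\ forall y, lt y x -> ~ big y.
  elim/(well_founded_ind ltwf): x0 bigx0 => x IH bigx.
  have [[y [yx bigy]]|nox] := pselect (exists y, lt y x /\ big y).
    exact: IH yx bigy.
  by exists x; split=> // y yx bigy; apply: nox; exists y.
(* If the segment below [x] is empty, then so are [B] and [A], and this case is contradictory. *)
have [A0|nA0] := pselect ([set y | A y /\ lt y x] !=set0); last first.
  exists lt; split=> // [y z _ _|y Ay By]; first exact: lt_total.
  have := card_le_trans AB Bx.
  suff -> : [set y | A y /\ lt y x] = set0.
    by move=> /card_le0P A0; move: Ay; rewrite A0.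
  by apply/seteqP; split=> // z Az; apply: nA0; exists z.
have [f [fA finj]] := card_le_fun (card_le_trans AB Bx) A0.
exists (fun y z => lt (f y) (f z)); split.
- exact: wf_inverse_image.
- by move=> y z Ay Az yz; apply: lt_total => /finj fyz; apply: yz;
  apply: fyz; rewrite inE.
(* [f] embeds the new segment below [z] into the old one below [f z], so [f z] would be big, against
   the minimality of [x]. *)
- move=> z Az Bz; have [Afz fzx] := fA _ Az.
  apply: (xmin _ fzx); split=> //; apply: card_le_trans Bz _.
  apply: (@inj_fun_card_le _ _ _ _ f) => [y [Ay yz]|y y'].
    by split=> //; have [] := fA _ Ay.
  by move=> /set_mem[Ay _] /set_mem[Ay' _]; apply: finj; rewrite inE.
Qed.

(** [F x] only looks at values below [x], so filling in the default [u] elsewhere does not change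
    its result. *)
Lemma well_founded_rec (T U : Type) (lt : T -> T -> Prop)
    (F : T -> (T -> U) -> U) : inhabited U -> well_founded lt ->
  (forall x f g, (forall y, lt y x -> f y = g y) -> F x f = F x g) ->
  exists f, forall x, f x = F x f.
Proof.
move=> [u] ltwf Fext.
pose G x (rec : forall y, lt y x -> U) :=
  F x (fun y => if pselect (lt y x) is left yx then rec y yx else u).
exists (Fix ltwf (fun=> U) G) => x; rewrite Fix_eq => [|y f g fg].
  by apply: Fext => y yx; case: pselect.
by congr (F y _); apply/funext => z; case: pselect.
Qed.

Lemma coloring_breaking_maps (V : Type) (E : set (V -> V)) (M : Type) :
    infinite_set [set: M] -> E #<= [set: M] ->
    (forall phi, E phi -> [set: M] #<= moved phi) ->
  exists c : V -> bool, forall phi, E phi -> ~ preserves c phi.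
Proof.
move=> Minf /initial_well_order[lt [ltwf lt_total seg_small]] motionE.
have [[v0]|V0] := pselect (inhabited V); last first.
  exists (fun=> true) => phi /motionE; suff -> : moved phi = set0.
    by move=> /card_le0P M0; case: Minf; rewrite M0; exact: finite_set0.
  by apply/seteqP; split=> // x; case: V0.
pose free (v : (V -> V) -> V) phi : set V := [set w | phi w <> w /\
  forall psi, lt psi phi -> E psi -> w <> v psi /\ w <> psi (v psi)].
have [|//|phi f g fg|v vE] :=
    @well_founded_rec _ V lt (fun phi v => @xget {classic V} v0 (free v phi)).
- exact: inhabits v0.
- congr (@xget {classic V} v0 _); apply/seteqP; split=> w [mw frw];
    split=> // psi lpsi Epsi.
    by rewrite -fg//; exact: frw.
  by rewrite fg//; exact: frw.
have vP phi : E phi -> free v phi (v phi).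
  move=> Ephi; rewrite vE; apply: (@xgetPex {classic V}); apply: contrapT => nofree.
  (* If nothing is free, each vertex moved by [phi] is [v psi] or [psi (v psi)] with [psi] in [Sg].
     Then [Sg] is infinite, doubling does not enlarge it, and [M] embeds into a proper initial
     segment. *)
  set Sg := [set psi | E psi /\ lt psi phi].
  have MSg2 : [set: M] #<= Sg `*` [set: bool].
    apply: card_le_trans (motionE _ Ephi) _.
    apply: card_le_trans (card_image_le
      (fun z : (V -> V) * bool => if z.2 then v z.1 else z.1 (v z.1)) _).
    apply: subset_card_le => w mw; apply: contrapT => nw.
    apply: nofree; exists w; split=> // psi lpsi Epsi.
    by split=> wE; apply: nw; [exists (psi, true)|exists (psi, false)].
  apply: (seg_small _ Ephi); apply: (card_le_trans MSg2).
  apply: card_le_setX_bool => Sgfin.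
  by apply: Minf; apply: card_le_finite MSg2 _; exact: finite_setX.
(* Color a picked vertex [v phi] by [true] iff [phi (v phi)] is not colored
   [true]; the other vertices are colored [false]. *)
pose inner (k : (V -> V) -> bool) phi psi :=
  [/\ lt psi phi, E psi, v psi = phi (v phi) & k psi].
have [|//|phi f g fg|k kE] :=
    @well_founded_rec _ bool lt (fun phi k => `[< ~ exists psi, inner k phi psi >]).
- exact: inhabits true.
- congr (`[< ~ _ >]); apply/propext; split=> -[psi [lpsi Epsi vpsi kpsi]].
    by exists psi; split=> //; rewrite -fg.
  by exists psi; split=> //; rewrite fg.
exists (fun w => `[< exists phi, [/\ E phi, v phi = w & k phi] >]).
have v_inj phi psi : E phi -> E psi -> v phi = v psi -> phi = psi.
  move=> Ephi Epsi vv; apply: contrapT => /(lt_total _ _ Ephi Epsi)[ll|ll].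
    by have [_ /(_ _ ll Ephi)[nv _]] := vP _ Epsi; exact/nv/esym.
  by have [_ /(_ _ ll Epsi)[nv _]] := vP _ Ephi.
(* [psi = phi] fails because [phi] moves [v phi]; a later [psi] would have avoided [phi (v phi)]. *)
have v_lt phi psi : E phi -> E psi -> v psi = phi (v phi) -> lt psi phi.
  move=> Ephi Epsi vv; have [mphi _] := vP _ Ephi.
  have [pp|/(lt_total _ _ Ephi Epsi)[ll|//]] := pselect (phi = psi).
    by case: mphi; rewrite -vv pp.
  by have [_ /(_ _ ll Ephi) [_]] := vP _ Epsi.
(* Preservation gives [v phi] and [phi (v phi)] the same color, which contradicts the equation for
   [k phi] whichever value [k phi] has. *)
move=> phi Ephi cphi; have [ck kc] := asbool_eq_equiv (cphi (v phi)).
have [kphi|nkphi] := pselect (k phi).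
  move: (kphi); rewrite kE => /asboolP; apply.
  have [psi [Epsi vpsi kpsi]] := kc (ex_intro _ phi (And3 Ephi erefl kphi)).
  by exists psi; split=> //; exact: v_lt.
have [psi [_ Epsi vpsi kpsi]] : exists psi, inner k phi psi.
  by apply: contrapT => no; apply: nkphi; rewrite kE; apply/asboolP.
have [chi [Echi vchi kchi]] := ck (ex_intro _ psi (And3 Epsi vpsi kpsi)).
by apply: nkphi; rewrite -(v_inj _ _ Echi Ephi vchi).
Qed.

Theorem theorem7 (V : Type) (G : sgraph V) (M : Type)
  (Gconn : connected_graph G)
  (motionG : is_endo_motion G M)
  (uncountableM : ~ countable [set: M])
  (EndG_le : End G #<= [set: M]) :
  is_endo_dist_number G 'I_2.
Proof.
have [[phi0 [Ephi0 nphi0 _]] motion_le] := motionG; split.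
  have [||phi [Ephi nphi]|c cP] :=
      @coloring_breaking_maps V (End G `&` [set phi | phi <> id]) M.
  - by move=> Mfin; apply: uncountableM; exact: finite_set_countable.
  - by apply: card_le_trans EndG_le; apply: subset_card_le => phi [].
  - exact: motion_le.
  exists (fun v => inord (c v)) => phi Ephi cphi; apply: contrapT => nphi.
  apply: (cP phi) => // v; have /(congr1 val) := cphi v.
  by rewrite /= !inordK; case: (c v); case: (c (phi v)).
(* Without two distinct labels, [phi0] would preserve [c] and hence be the identity. *)
move=> L c cP; have [[a [b ab]]|nL] := pselect (exists a b : L, a <> b); last first.
  case: nphi0; apply: cP => // v; apply: contrapT => nc.
  by apply: nL; exists (c (phi0 v)), (c v).
apply: (@inj_fun_card_le _ _ _ _ (fun i : 'I_2 => if i == ord0 then a else b)).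
  by [].
move=> [[|[|//]] i] [[|[|//]] j] _ _ //= abij; try exact: val_inj.
by case: ab.
Qed.
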